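(* Let $(X,\to,{}^*,1)$ be a quantum-Wajsberg algebra with $0=1^*$, and let $\mathcal{Z}(X)=\{x\in X\mid x\Cap y=y\Cap x\text{ for all }y\in X\}$. Then $(\mathcal{Z}(X),\Cap,\Cup,{}^*,0,1)$ is a Kleene algebra.
   Context: A BE algebra is an algebra $(X,\to,1)$ of type $(2,0)$ such that for all $x,y,z\in X$: $x\to x=1$; $x\to 1=1$; $1\to x=x$; $x\to(y\to z)=y\to(x\to z)$. It is bounded if there is $0\in X$ with $0\to x=1$ for all $x$; then $x^*:=x\to 0$. A bounded BE algebra is involutive if $x^{**}=x$ for all $x$; it is written $(X,\to,{}^*,1)$, with $0=1^*$. In an involutive BE algebra put $x\Cup y=(x\to y)\to y$ and $x\Cap y=((x^*\to y^* )\to y^* )^*$. A quantum-Wajsberg algebra is an involutive BE algebra $(X,\to,{}^*,1)$ satisfying, for all $x,y,z\in X$, $x\to((x\Cap y)\Cap(z\Cap x))=(x\to y)\Cap(x\to z)$. A Kleene algebra is a structure $(L,\wedge,\vee,{}^*,0,1)$ where $(L,\wedge,\vee,0,1)$ is a bounded distributive lattice and ${}^*$ is a unary operation such that for all $x,y\in L$: $(x^* )^*=x$; $(x\vee y)^*=x^*\wedge y^*$; $x\wedge x^*\le y\vee y^*$ (lattice order). *)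

(* Defs.v *)
From HB Require Import structures.
From mathcomp Require Import all_boot all_order.

Set Implicit Arguments.
Unset Strict Implicit.
Unset Printing Implicit Defensive.

Import Order.Theory.
Local Open Scope order_scope.

Declare Scope be_scope.
Delimit Scope be_scope with BE.
Local Open Scope be_scope.

Reserved Notation "x ⇒ y" (at level 55, right associativity).
Reserved Notation "x ⋓ y" (at level 50, left associativity).
Reserved Notation "x ⋒ y" (at level 48, left associativity).

HB.mixin Record isBEAlgebra (X : Type) := {
  be_imp : X -> X -> X;
  be_one : X;
  be_impxx : forall x, be_imp x x = be_one;
  be_impx1 : forall x, be_imp x be_one = be_one;
  be_imp1x : forall x, be_imp be_one x = x;
  be_impCA : forall x y z, be_imp x (be_imp y z) = be_imp y (be_imp x z)
}.

#[short(type="beAlgebraType")]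
HB.structure Definition BEAlgebra := {X of isBEAlgebra X}.

Notation "x ⇒ y" := (be_imp x y) : be_scope.

HB.mixin Record isBoundedBE X of BEAlgebra X := {
  be_zero : X;
  be_imp0x : forall x : X, be_zero ⇒ x = be_one
}.

#[short(type="boundedBEType")]
HB.structure Definition BoundedBE := {X of isBoundedBE X & BEAlgebra X}.

Definition be_star (X : boundedBEType) (x : X) : X := x ⇒ be_zero.

Notation "x ^*" := (be_star x) : be_scope.

HB.mixin Record isInvolutiveBE X of BoundedBE X := {
  be_starK : forall x : X, x^*^* = x
}.

#[short(type="involutiveBEType")]
HB.structure Definition InvolutiveBE := {X of isInvolutiveBE X & BoundedBE X}.

Lemma be_star1 (X : boundedBEType) : (be_one : X)^* = be_zero.
Proof. exact: be_imp1x. Qed.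

Definition be_cup (X : involutiveBEType) (x y : X) : X := (x ⇒ y) ⇒ y.

Definition be_cap (X : involutiveBEType) (x y : X) : X :=
  ((x^* ⇒ y^*) ⇒ y^*)^*.

Notation "x ⋓ y" := (be_cup x y) : be_scope.
Notation "x ⋒ y" := (be_cap x y) : be_scope.

HB.mixin Record isQuantumWajsberg X of InvolutiveBE X := {
  qw_axiom : forall x y z : X,
    x ⇒ ((x ⋒ y) ⋒ (z ⋒ x)) = (x ⇒ y) ⋒ (x ⇒ z)
}.

#[short(type="quantumWajsbergType")]
HB.structure Definition QuantumWajsberg :=
  {X of isQuantumWajsberg X & InvolutiveBE X}.

Definition qw_center (X : quantumWajsbergType) (x : X) : Prop :=
  forall y : X, x ⋒ y = y ⋒ x.

HB.mixin Record isKleeneAlgebra (d : Order.disp_t) L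
    of Order.TBDistrLattice d L := {
  kleene_star : L -> L;
  kleene_starK : forall x : L, kleene_star (kleene_star x) = x;
  kleene_starU : forall x y : L,
    kleene_star (x `|` y) = kleene_star x `&` kleene_star y;
  kleene_le : forall x y : L, x `&` kleene_star x <= y `|` kleene_star y
}.

#[short(type="kleeneAlgebraType")]
HB.structure Definition KleeneAlgebra (d : Order.disp_t) :=
  {L of isKleeneAlgebra d L & Order.TBDistrLattice d L}.

(* The subset S of X is closed under the given operations and, with their
   restrictions, is a Kleene algebra: the carrier of L is the subtype of S
   itself. The decidable order and choice operator carried by a MathComp
   lattice exist classically on any type, so they impose no restriction. *)
Definition is_kleene_algebra_on (X : Type) (S : X -> Prop)
    (meet join : X -> X -> X) (star : X -> X) (zero one : X) : Prop :=
  exists (d : Order.disp_t) (K : KleeneAlgebra.axioms_ d {x : X | S x}),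
    let L : kleeneAlgebraType d := KleeneAlgebra.Pack K in
    [/\ forall a b : L, sval (a `&` b) = meet (sval a) (sval b),
        forall a b : L, sval (a `|` b) = join (sval a) (sval b),
        forall a : L, sval (kleene_star a) = star (sval a),
        sval (\bot : L) = zero
      & sval (\top : L) = one].

(* Main.v *)
(* Write u <=_Q v for u = u ⋒ v. This is a partial order for which ⇒ is
   antitone on the left and monotone on the right, and v >=_Q u exactly when v
   has the form r ⇒ u. If x is central then x ⋒ y is the <=_Q-infimum of x and
   y for every y, so closure of the center under ⋒ amounts to z ⋒ (x ⋒ y) <=_Q z
   for arbitrary z; that follows from
     (x ⋒ y) ⇒ z = (y ⇒ x) ⇒ (y ⇒ z)  and  (y ⇒ z) ⋒ (y ⇒ x) = y ⇒ (z ⋒ x).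
   The second identity, for central x and y, also gives distributivity, and the
   Kleene inequality follows from prelinearity (x ⇒ y) ⋓ (y ⇒ x) = 1: both x ⇒ y
   and y ⇒ x lie below (x ⋒ x') ⇒ (y ⋓ y'), with ' the involution. *)
From HB Require Import structures.
From mathcomp Require Import all_boot all_order boolp.
Require Import Defs.

Set Implicit Arguments.
Unset Strict Implicit.
Unset Printing Implicit Defensive.

Import Order.Theory.
Local Open Scope be_scope.

(** * Contraposition and identities of involutive BE algebras *)

Section InvolutiveBE.
Variable X : involutiveBEType.
Implicit Types x y z : X.

Lemma imp_starC x y : x ⇒ y = y^* ⇒ x^*.
Proof. by rewrite -{1}(be_starK y) /be_star be_impCA. Qed.

Lemma be_star0 : (be_zero : X)^* = be_one.
Proof. exact: be_imp0x. Qed.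

Lemma star_inj : injective (@be_star X).
Proof. by move=> x y e; rewrite -(be_starK x) e be_starK. Qed.

Lemma capE x y : x ⋒ y = ((y ⇒ x) ⇒ y^*)^*.
Proof. by rewrite /be_cap -imp_starC. Qed.

Lemma star_cap x y : (x ⋒ y)^* = x^* ⋓ y^*.
Proof. by rewrite be_starK. Qed.

Lemma star_cup x y : (x ⋓ y)^* = x^* ⋒ y^*.
Proof. by rewrite /be_cap !be_starK. Qed.

Lemma capxx x : x ⋒ x = x.
Proof. by rewrite capE be_impxx be_imp1x be_starK. Qed.

Lemma capx1 x : x ⋒ be_one = x.
Proof. by rewrite capE be_imp1x be_star1 be_starK. Qed.

Lemma cap1x x : be_one ⋒ x = x.
Proof. by rewrite capE be_impx1 be_imp1x be_starK. Qed.

Lemma cap0x x : be_zero ⋒ x = be_zero.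
Proof. by rewrite capE -/(be_star x) be_impxx be_star1. Qed.

Lemma capx0 x : x ⋒ be_zero = be_zero.
Proof. by rewrite capE be_imp0x be_star0 be_impx1 be_star1. Qed.

Lemma cap_imp1 x y : y ⇒ x = be_one -> x ⋒ y = y.
Proof. by rewrite capE => ->; rewrite be_imp1x be_starK. Qed.

Lemma imp_capr1 x y : (x ⋒ y) ⇒ y = be_one.
Proof. by rewrite imp_starC capE be_starK be_impCA be_impxx be_impx1. Qed.

(** After contraposition the starred meet is an implication from [y ⇒ x]; exchange moves that
    premise to the front. *)
Lemma cap_imp x y z : (x ⋒ y) ⇒ z = (y ⇒ x) ⇒ (y ⇒ z).
Proof.
by rewrite [LHS]imp_starC capE be_starK [LHS]be_impCA -(imp_starC y z).
Qed.

End InvolutiveBE.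

(** * The partial order [leQ] and monotonicity *)

Section QuantumWajsberg.
Variable X : quantumWajsbergType.
Implicit Types c k u v w x y z : X.

Definition leQ u v := u = u ⋒ v.

Lemma imp_capr x y : x ⇒ (y ⋒ x) = x ⇒ y.
Proof.
have := qw_axiom x be_one y; rewrite capx1 be_impx1 cap1x => <-.
by rewrite [x ⋒ (y ⋒ x)]cap_imp1 // imp_capr1.
Qed.

Lemma imp_capl x y : x ⇒ (x ⋒ y) = x ⇒ y.
Proof. by have := qw_axiom x y be_one; rewrite cap1x be_impx1 capx1 imp_capr. Qed.

Lemma leQ_refl u : leQ u u.
Proof. by rewrite /leQ capxx. Qed.

Lemma leQ1 u : leQ u be_one.
Proof. by rewrite /leQ capx1. Qed.

Lemma leQ_imp u v : leQ u v -> u ⇒ v = be_one.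
Proof. by move->; apply: imp_capr1. Qed.

Lemma leQ_cap u v : leQ u v -> v ⋒ u = u.
Proof. by move=> /leQ_imp/cap_imp1. Qed.

Lemma leQ_anti u v : leQ u v -> leQ v u -> u = v.
Proof. by move=> /leQ_cap uv vu; rewrite -uv -vu. Qed.

(** The axiom with [be_zero] in the middle: its left side collapses to [x ⇒ be_zero]. *)
Lemma leQ_imp_star x y : leQ x^* (x ⇒ y).
Proof. by have := qw_axiom x be_zero y; rewrite capx0 cap0x => e; exact: e. Qed.

Lemma leQ_impr x y : leQ x (y ⇒ x).
Proof. by rewrite imp_starC -{1}(be_starK x); apply: leQ_imp_star. Qed.

Lemma leQ_star u v : leQ u v -> leQ v^* u^*.
Proof.
move=> uv; have -> : u^* = v ⇒ (v ⇒ u)^*; last exact: leQ_imp_star.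
by rewrite {1}uv capE be_starK [LHS]imp_starC be_starK.
Qed.

Lemma leQ_starP u v : leQ u v <-> leQ v^* u^*.
Proof. by split; [exact: leQ_star | move/leQ_star; rewrite !be_starK]. Qed.

(** Star dual of [u = u ⋒ v]. It writes any element above [u] as an implication into [u]. *)
Lemma leQ_cupE u v : leQ u v -> (v ⇒ u) ⇒ u = v.
Proof. by move=> /leQ_star uv; apply: star_inj; rewrite star_cup -uv. Qed.

Lemma leQ_trans v u w : leQ u v -> leQ v w -> leQ u w.
Proof.
move=> /leQ_cupE uv /leQ_cupE <-; rewrite -uv.
set r := w ⇒ _; set s := v ⇒ u.
(* The star of [r ⇒ s^*] acts as a product of [r] and [s]: it fuses the two premises into one, so
   [w] is again an implication into [u]. *)
suff -> : r ⇒ (s ⇒ u) = (r ⇒ s^*)^* ⇒ u by apply: leQ_impr.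
by rewrite (imp_starC s u) be_impCA [RHS]imp_starC be_starK.
Qed.

Lemma leQ_imp2l x u v : leQ u v -> leQ (x ⇒ u) (x ⇒ v).
Proof. by move=> /leQ_cupE <-; rewrite be_impCA; apply: leQ_impr. Qed.

Lemma leQ_imp2r x u v : leQ u v -> leQ (v ⇒ x) (u ⇒ x).
Proof.
by move=> uv; rewrite (imp_starC v) (imp_starC u); apply/leQ_imp2l/leQ_star.
Qed.

Lemma leQ_capr x y : leQ (x ⋒ y) y.
Proof. by apply/leQ_starP; rewrite capE be_starK; apply: leQ_impr. Qed.

Lemma leQ_cap2 y u v : leQ u v -> leQ (u ⋒ y) (v ⋒ y).
Proof. by move=> uv; rewrite !capE; apply/leQ_star/leQ_imp2r/leQ_imp2l. Qed.

(* Giuntini's weak associativity [(z ⋒ y) ⋒ (y ⋒ x) = (z ⋒ y) ⋒ x]. *)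
Lemma leQ_capA k x y : leQ k y -> k ⋒ (y ⋒ x) = k ⋒ x.
Proof.
move=> ky; rewrite !(capE k) cap_imp; congr be_star.
set A := x ⇒ y; set B := x ⇒ k.
have AB : B = B ⋒ A by apply: leQ_imp2l.
rewrite capE be_starK -/A [LHS]be_impCA [(A ⇒ B) ⇒ x^*]imp_starC be_starK.
rewrite [LHS]be_impCA.
have -> : A ⇒ (A ⇒ B)^* = B^*.
  by rewrite {2}AB capE be_starK [LHS]imp_starC be_starK.
by rewrite [LHS]imp_starC be_starK.
Qed.

(** * Central elements and closure of the center *)

Lemma cap_cupC x y : x ⋒ y = y ⋒ x -> x ⋓ y = y ⋓ x.
Proof.
move=> xy; have mx : leQ (x ⋒ y) x by rewrite xy; apply: leQ_capr.
have my := leQ_capr x y; rewrite /be_cup.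
(* Both implications now end in the common lower bound [m]. Writing [y] as [(y ⇒ m) ⇒ m], and
   likewise [x], makes the two sides differ by an exchange. *)
rewrite -(imp_capl x y) -(imp_capr y x); move: (x ⋒ y) mx my => m mx my.
by rewrite -[X in _ ⇒ X = _](leQ_cupE my) -[X in _ = _ ⇒ X](leQ_cupE mx) be_impCA.
Qed.

Lemma central_star x : qw_center x -> qw_center x^*.
Proof.
move=> cx y; apply: star_inj; rewrite !star_cap be_starK.
exact/cap_cupC/cx.
Qed.

Lemma leQ_capl x y : qw_center y -> leQ (x ⋒ y) x.
Proof. by move=> cy; rewrite -cy; apply: leQ_capr. Qed.

Lemma leQ_glb u x y : leQ u x -> leQ u y -> leQ u (x ⋒ y).
Proof. by move=> ux uy; rewrite {1}uy; apply: leQ_cap2. Qed.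

(** Converse of [leQ_imp] for a central bound; order claims then reduce to implication
    identities. *)
Lemma leQ_central u v : qw_center v -> u ⇒ v = be_one -> leQ u v.
Proof. by move=> cv uv; rewrite /leQ -cv cap_imp1. Qed.

Lemma central_cap2_le x y z : qw_center x -> qw_center y ->
  leQ ((z ⋒ x) ⋒ y) ((z ⋒ y) ⋒ x).
Proof.
move=> cx cy; apply: leQ_glb; first exact/leQ_cap2/leQ_capl.
exact: leQ_trans (leQ_capl _ cy) (leQ_capr _ _).
Qed.

Lemma central_capAC x y z : qw_center x -> qw_center y ->
  (z ⋒ x) ⋒ y = (z ⋒ y) ⋒ x.
Proof. by move=> cx cy; apply: leQ_anti; apply: central_cap2_le. Qed.

(** The axiom, regrouped: as [z ⋒ y] lies below [y], [leQ_capA] removes one copy of [y] from the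
    meet and [imp_capr] the other. *)
Lemma central_imp_cap x y z : qw_center x -> qw_center y ->
  (y ⇒ z) ⋒ (y ⇒ x) = y ⇒ (z ⋒ x).
Proof.
move=> cx cy; rewrite -qw_axiom cy cx leQ_capA; last exact: leQ_capr.
by rewrite central_capAC // imp_capr.
Qed.

Lemma central_cap x y : qw_center x -> qw_center y -> qw_center (x ⋒ y).
Proof.
move=> cx cy z; set m := x ⋒ y; set g := (z ⋒ x) ⋒ y.
have gz : leQ g z by apply: leQ_trans (leQ_capl _ cy) (leQ_capl _ cx).
have gm : leQ g m by apply/leQ_cap2/leQ_capr.
have <- : g = z ⋒ m.
  (* A meet [_ ⋒ m] depends on its left argument only through [m ⇒ _], so it suffices that
     [m ⇒ z = m ⇒ g]. *)
  have -> : z ⋒ m = g ⋒ m.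
    rewrite !(capE _ m) /m !cap_imp.
    by rewrite -(imp_capr _ (y ⇒ z)) central_imp_cap // -(imp_capr y (z ⋒ x)).
  exact: gm.
(* It remains to compare [m ⋒ z] with [g]; centrality of [x] and [y] places [m ⋒ z] below both,
   hence below [g]. *)
apply: leQ_anti; last exact: leQ_glb.
have mzm : forall v, leQ m v -> leQ (m ⋒ z) (v ⋒ z) by move=> v; apply: leQ_cap2.
apply: leQ_glb; first apply: leQ_glb; first exact: leQ_capr.
  by apply: leQ_trans (mzm _ (leQ_capl _ cy)) _; rewrite cx; apply: leQ_capr.
by apply: leQ_trans (mzm _ (leQ_capr _ _)) _; rewrite cy; apply: leQ_capr.
Qed.

Lemma central_cup x y : qw_center x -> qw_center y -> qw_center (x ⋓ y).
Proof.
move=> cx cy; rewrite -(be_starK (x ⋓ y)) star_cup.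
by apply/central_star/central_cap; apply: central_star.
Qed.

Lemma central0 : qw_center (be_zero : X).
Proof. by move=> y; rewrite cap0x capx0. Qed.

Lemma central1 : qw_center (be_one : X).
Proof. by move=> y; rewrite cap1x capx1. Qed.

(** * Joins, distributivity and the Kleene inequality *)

Lemma leQ_cupr x y : leQ y (x ⋓ y).
Proof. exact: leQ_impr. Qed.

Lemma leQ_cupl x y : qw_center x -> leQ x (x ⋓ y).
Proof. by move=> cx; rewrite cap_cupC //; apply: leQ_cupr. Qed.

Lemma leQ_lub x y u : leQ x u -> leQ y u -> leQ (x ⋓ y) u.
Proof.
move=> /leQ_star xu /leQ_star yu; apply/leQ_starP.
by rewrite star_cup; apply: leQ_glb.
Qed.

(** Contraposition reduces this to [central_imp_cap] for the starred elements. *)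
Lemma leQ_imp_lub c x y w : qw_center x -> qw_center y -> qw_center w ->
  leQ c (x ⇒ w) -> leQ c (y ⇒ w) -> leQ c ((x ⋓ y) ⇒ w).
Proof.
move=> /central_star cx /central_star cy /central_star cw.
rewrite (imp_starC x) (imp_starC y) => cxw cyw.
rewrite imp_starC star_cup -central_imp_cap //.
exact: leQ_glb.
Qed.

Lemma central_distr x y z : qw_center x -> qw_center y -> qw_center z ->
  x ⋒ (y ⋓ z) = (x ⋒ y) ⋓ (x ⋒ z).
Proof.
move=> cx cy cz; set t := y ⋓ z; set w := _ ⋓ (_ ⋒ _).
have cxy := central_cap cx cy; have cxz := central_cap cx cz.
have cw : qw_center w by apply: central_cup.
have yt : leQ y t by apply: leQ_cupl.
have zt : leQ z t by apply: leQ_cupr.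
apply: leQ_anti; last first.
  by apply: leQ_lub; rewrite !(cx : forall u, x ⋒ u = u ⋒ x); apply: leQ_cap2.
(* It now suffices that [t ⇒ x] is below [t ⇒ w]; as [t] is a join, [leQ_imp_lub] splits this over
   [y] and [z]. *)
apply: leQ_central => //; rewrite cap_imp.
have imp_le v : leQ v t -> leQ (x ⋒ v) w -> leQ (t ⇒ x) (v ⇒ w).
  move=> vt vw; apply: leQ_trans (leQ_imp2r _ vt) _.
  by rewrite -imp_capr; apply: leQ_imp2l.
apply: leQ_imp; apply: leQ_imp_lub => //; apply: imp_le => //.
  exact: leQ_cupl.
exact: leQ_cupr.
Qed.

Lemma central_prelinear x y : qw_center x -> (x ⇒ y) ⋓ (y ⇒ x) = be_one.
Proof.
move=> cx; have mx : leQ (x ⋒ y) x by rewrite cx; apply: leQ_capr.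
(* With [m = x ⋒ y] the left side is [(x ⇒ m) ⇒ (y ⇒ m)]; exchange exposes [(x ⇒ m) ⇒ m], which is
   [x]. *)
have de : (x ⇒ y) ⇒ (y ⇒ x) = y ⇒ x.
  rewrite -{1}(imp_capl x y) -{1}(imp_capr y x) be_impCA.
  by rewrite (leQ_cupE mx).
by rewrite /be_cup de be_impxx.
Qed.

Lemma central_kleene x y : qw_center x -> qw_center y ->
  leQ (x ⋒ x^*) (y ⋓ y^*).
Proof.
move=> cx cy; have csx := central_star cx; have csy := central_star cy.
apply: leQ_central; first exact: central_cup.
have le_imp u v p q : leQ u p -> leQ q v -> leQ (p ⇒ q) (u ⇒ v).
  by move=> up qv; apply: leQ_trans (leQ_imp2r _ up) (leQ_imp2l _ qv).
apply: leQ_anti; first exact: leQ1.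
rewrite -(central_prelinear y cx); apply: leQ_lub.
  by apply: le_imp; [apply: leQ_capl | apply: leQ_cupl].
(* As [x^* ⇒ y^*], the second implication is bounded through the starred halves. *)
by rewrite (imp_starC y); apply: le_imp; [apply: leQ_capr | apply: leQ_cupr].
Qed.

End QuantumWajsberg.

(** * The Kleene algebra on the subtype of central elements *)

Section Center.
Variable X : quantumWajsbergType.

Definition center : Type := {x : X | qw_center x}.

HB.instance Definition _ := gen_eqMixin center.
HB.instance Definition _ := gen_choiceMixin center.

Implicit Types a b c : center.

(** Proof irrelevance identifies the two proofs of centrality. *)
Lemma center_inj a b : sval a = sval b -> a = b.
Proof.
by case: a b => [x cx] [y cy] /= xy; case: y / xy cy => cy; congr exist.
Qed.

Definition center_meet a b : center :=
  exist _ (sval a ⋒ sval b) (central_cap (svalP a) (svalP b)).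
Definition center_join a b : center :=
  exist _ (sval a ⋓ sval b) (central_cup (svalP a) (svalP b)).
Definition center_star a : center :=
  exist _ (sval a)^* (central_star (svalP a)).
Definition center0 : center := exist _ be_zero (@central0 X).
Definition center1 : center := exist _ be_one (@central1 X).
(** The classical decidable equality makes [leQ] a boolean relation here. *)
Definition center_le a b := a == center_meet a b.

Lemma center_leP a b : reflect (leQ (sval a) (sval b)) (center_le a b).
Proof. by apply: (iffP eqP) => [-> | ab]; [exact: leQ_capr | exact: center_inj]. Qed.

Lemma center_le_refl : reflexive center_le.
Proof. by move=> a; apply/center_leP/leQ_refl. Qed.

Lemma center_le_anti : antisymmetric center_le.
Proof.
by move=> a b /andP[/center_leP ab /center_leP ba]; apply/center_inj/leQ_anti.
Qed.

Lemma center_le_trans : transitive center_le.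
Proof.
by move=> b a c /center_leP ab /center_leP bc; apply/center_leP/(leQ_trans ab).
Qed.

HB.instance Definition _ := Order.Le_isPOrder.Build (Order.Disp tt tt) center
  center_le_refl center_le_anti center_le_trans.

Lemma center_meetP a b c : (a <= center_meet b c)%O = (a <= b)%O && (a <= c)%O.
Proof.
apply/center_leP/andP => [abc | [/center_leP ab /center_leP ac]].
  split; apply/center_leP/(leQ_trans abc); last exact: leQ_capr.
  exact/leQ_capl/svalP.
exact: leQ_glb.
Qed.

Lemma center_joinP a b c : (center_join a b <= c)%O = (a <= c)%O && (b <= c)%O.
Proof.
apply/center_leP/andP => [abc | [/center_leP ab /center_leP ac]].
  split; apply/center_leP/(leQ_trans _ abc); last exact: leQ_cupr.
  exact/leQ_cupl/svalP.
exact: leQ_lub.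
Qed.

HB.instance Definition _ := Order.POrder_MeetJoin_isLattice.Build _ center
  center_meetP center_joinP.

Lemma center_meetUl :
  @left_distributive center center Order.meet Order.join.
Proof.
move=> a b c; rewrite !(meetC _ c); apply: center_inj.
by apply: central_distr; apply: svalP.
Qed.

HB.instance Definition _ :=
  Order.Lattice_Meet_isDistrLattice.Build _ center center_meetUl.

Lemma center_le0 a : (center0 <= a)%O.
Proof. by apply/center_leP; rewrite /leQ /= cap0x. Qed.

Lemma center_le1 a : (a <= center1)%O.
Proof. exact/center_leP/leQ1. Qed.

HB.instance Definition _ := Order.hasBottom.Build _ center center_le0.
HB.instance Definition _ := Order.hasTop.Build _ center center_le1.

Lemma center_starK a : center_star (center_star a) = a.
Proof. by apply: center_inj; apply: be_starK. Qed.

Lemma center_starU a b :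
  center_star (a `|` b)%O = (center_star a `&` center_star b)%O.
Proof. by apply: center_inj; apply: star_cup. Qed.

Lemma center_kleene a b :
  (a `&` center_star a <= b `|` center_star b)%O.
Proof. by apply/center_leP; apply: central_kleene; apply: svalP. Qed.

HB.instance Definition _ := isKleeneAlgebra.Build _ center
  center_starK center_starU center_kleene.

End Center.

Theorem theorem4p8 (X : quantumWajsbergType) :
  is_kleene_algebra_on (@qw_center X) (@be_cap X) (@be_cup X)
    (@be_star X) (@be_zero X) (@be_one X).
Proof.
(* The five compatibility equations hold by computation. *)
by eexists; exists (KleeneAlgebra.class (center X : kleeneAlgebraType _)).
Qed.
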